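(* Let $I \subset \mathbb{R}$ be a nondegenerate interval. For every $\theta \in [0,1]$ there exists a max-family $(f_n \colon I \to \mathbb{R})_{n=1}^\infty$ such that $\dim_H I_f = \theta$ and $I_f$ can be decomposed as $I_f = A \cup B$, where $A$ is a nowhere dense set and $B$ is a set of Hausdorff dimension zero.
   Context: For a sequence $(f_n)_{n=1}^\infty$ of continuous functions $f_n \colon I \to \mathbb{R}$ with $f_1 \le f_2 \le \cdots$ (pointwise), define $I_f := \{x \in I : \lim_{n\to\infty} f_n(x) = +\infty\}$. Such a sequence (continuous and pointwise nondecreasing in $n$) is called a max-family if $\lim_{n\to\infty} \int_x^y f_n(t)\,dt = +\infty$ for all $x,y \in I$ with $x<y$. $\dim_H$ denotes Hausdorff dimension. *)

(* Defs.v *)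
From mathcomp Require Import all_boot all_order all_algebra.
From mathcomp Require Import all_classical all_reals all_analysis.

Set Implicit Arguments.
Unset Strict Implicit.
Unset Printing Implicit Defensive.

Import Order.TTheory GRing.Theory Num.Theory.
Import numFieldNormedType.Exports.

Local Open Scope classical_set_scope.
Local Open Scope ring_scope.

(** [diam set0] is -oo, not 0; [diam_powR] treats the empty set separately. *)
Definition diam (R : realType) (U : set R) : \bar R :=
  ereal_sup [set `|p.1 - p.2|%:E | p in U `*` U].

(** The value 0 at [set0] matters for s = 0, where [poweR] gives 1 to every
    diameter (including 0): [hausdorff_measure 0] is then counting measure. *)
Definition diam_powR (R : realType) (s : R) (U : set R) : \bar R :=
  if U == set0 then 0%E else poweR (diam U) s.

Definition hausdorff_premeasure (R : realType) (s delta : R) (A : set R)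
    : \bar R :=
  ereal_inf [set (\sum_(0 <= i <oo) diam_powR s (U i))%E | U in
    [set U : nat -> set R | A `<=` \bigcup_i U i /\
                            forall i, (diam (U i) <= delta%:E)%E]].

(** The premeasure is nonincreasing in delta, so this supremum is its limit
    as delta tends to 0. *)
Definition hausdorff_measure (R : realType) (s : R) (A : set R) : \bar R :=
  ereal_sup [set hausdorff_premeasure s delta A | delta in
    [set delta : R | 0 < delta]].

Definition hausdorff_dim (R : realType) (A : set R) : \bar R :=
  ereal_inf [set s%:E | s in
    [set s : R | 0 <= s /\ hausdorff_measure s A = 0%E]].

Definition nowhere_dense (T : topologicalType) (A : set T) : Prop :=
  interior (closure A) = set0.

(** A function I -> R is represented by a total function R -> R whose values
    outside I are ignored; sequences are indexed from 0. *)
Definition max_family (R : realType) (I : set R) (f : nat -> R -> R) : Prop :=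
  [/\ forall n, {within I, continuous (f n)},
      forall x, I x -> nondecreasing_seq (fun n => f n x) &
      forall x y, I x -> I y -> x < y ->
        (\int[lebesgue_measure]_(t in `[x, y]) f n t) @[n --> \oo] --> +oo].

Definition infinity_set (R : realType) (I : set R) (f : nat -> R -> R)
    : set R :=
  [set x | I x /\ f n x @[n --> \oo] --> +oo].

(* Main.v *)
(** Take [f_n = g_n + h_n]. Here [g_n] is the sum of the first [n] tents, where
    the [k]-th tent has integral about [k] and tiny width [2^-(k^2)], and every
    rational is the center of infinitely many tents; [g_n] diverges only on a
    limsup of the supports, which has dimension 0. The other term is
    [h_n = 1 / (dist(., C) + 1/(n+1))], which diverges exactly on the closed
    set [C]. For [theta > 0], [C] is the closure of a Cantor set with [2^n]
    pieces of length [l_n = c r^n / (n+1)] at level [n], [r = 2^(-1/theta)].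
    Covering by these pieces gives [H^theta(C) = 0], so [C] is Lebesgue-null
    and nowhere dense. The map reading binary digits back from a point of the
    Cantor set is Hoelder of every exponent [s < theta] and onto [[0, 1[], so
    [H^s(C) > 0]. *)

Require Import Defs.
From mathcomp Require Import all_boot all_order all_algebra.
From mathcomp Require Import all_classical all_reals all_analysis.
From mathcomp Require Import zify ring lra.

Set Implicit Arguments.
Unset Strict Implicit.
Unset Printing Implicit Defensive.

Import Order.TTheory GRing.Theory Num.Theory.
Import numFieldNormedType.Exports.
Local Open Scope classical_set_scope.
Local Open Scope ring_scope.

(** * Hausdorff-null sets *)

Lemma diam_powR_ge0 (R : realType) (s : R) (U : set R) :
  (0 <= diam_powR s U)%E.
Proof. by rewrite /diam_powR; case: ifP => // _; exact: poweR_ge0. Qed.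

Lemma le_diam (R : realType) (U : set R) (x y : R) :
  U x -> U y -> (`|x - y|%:E <= diam U)%E.
Proof. by move=> Ux Uy; apply: ereal_sup_ubound; exists (x, y). Qed.

Lemma diam_le (R : realType) (U : set R) (d : R) :
  (forall x y, U x -> U y -> `|x - y| <= d) -> (diam U <= d%:E)%E.
Proof.
move=> Ud; apply: ge_ereal_sup => _ [[x y] [/= Ux Uy] <-].
by rewrite lee_fin Ud.
Qed.

Lemma dist_powR_le_diam_powR (R : realType) (s : R) (U : set R) (x y : R) :
  0 <= s -> U x -> U y -> ((`|x - y| `^ s)%:E <= diam_powR s U)%E.
Proof.
move=> s0 Ux Uy; rewrite /diam_powR ifN; last by apply/set0P; exists x.
rewrite -poweR_EFin; apply: gt0_ler_poweR => //.
- by rewrite in_itv /= leey lee_fin normr_ge0.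
- by rewrite in_itv /= leey andbT (le_trans _ (le_diam Ux Uy))// lee_fin.
- exact: le_diam.
Qed.

Lemma diam_powR_le (R : realType) (s : R) (U : set R) (d : R) :
  0 <= s -> 0 <= d -> (forall x y, U x -> U y -> `|x - y| <= d) ->
  (diam_powR s U <= (d `^ s)%:E)%E.
Proof.
move=> s0 d0 Ud; rewrite /diam_powR; case: ifPn => [_|/set0P[x Ux]].
  by rewrite lee_fin powR_ge0.
rewrite -poweR_EFin; apply: gt0_ler_poweR => //.
- by rewrite in_itv /= leey andbT (le_trans _ (le_diam Ux Ux))// lee_fin.
- by rewrite in_itv /= leey andbT lee_fin.
- exact: diam_le.
Qed.

(* Bounding partial sums rather than the series makes finite covers and unions
   of two covers easy to handle. *)
Definition hausdorff_null (R : realType) (s : R) (A : set R) : Prop :=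
  forall eps delta : R, 0 < eps -> 0 < delta ->
  exists U : nat -> set R,
    [/\ A `<=` \bigcup_i U i,
        forall i, (diam (U i) <= delta%:E)%E &
        forall n, (\sum_(0 <= i < n) diam_powR s (U i) <= eps%:E)%E].

(** Premeasures are nonnegative and their supremum is the measure, so measure zero forces every
    premeasure to vanish. Since the terms are nonnegative, a bound on all partial sums is a bound on
    the series. *)
Lemma hausdorff_measure_eq0 (R : realType) (s : R) (A : set R) :
  hausdorff_measure s A = 0%E <-> hausdorff_null s A.
Proof.
have pre0 d : (0 <= hausdorff_premeasure s d A)%E.
  apply: le_ereal_inf_tmp => _ [U _ <-].
  by apply: nneseries_ge0 => i _ _; exact: diam_powR_ge0.
split=> [A0 eps d e0 d0|A0].
  have : (hausdorff_premeasure s d A < eps%:E)%E.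
    apply: (@le_lt_trans _ _ 0%E); last by rewrite lte_fin.
    by rewrite -A0; apply: ereal_sup_ubound; exists d.
  move=> /ereal_inf_lt[_ [U [AU Ud] <-] Ue].
  exists U; split => // n; apply: le_trans (ltW Ue).
  by apply: nneseries_lim_ge => i _ _; exact: diam_powR_ge0.
apply/eqP; rewrite eq_le; apply/andP; split; last first.
  by apply: le_trans (pre0 1) _; apply: ereal_sup_ubound; exists 1 => //=.
apply: ge_ereal_sup => _ [d /= d0 <-].
apply/lee_addgt0Pr => e e0; rewrite add0e.
have [U [AU Ud Ue]] := A0 e d e0 d0.
apply: (@le_trans _ _ (\sum_(0 <= i <oo) diam_powR s (U i))%E).
  by apply: ereal_inf_lbound; exists U.
apply: lime_le; last by apply: nearW.
by apply: is_cvg_nneseries => i _ _; exact: diam_powR_ge0.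
Qed.

Lemma sub_hausdorff_null (R : realType) (s : R) (A B : set R) :
  A `<=` B -> hausdorff_null s B -> hausdorff_null s A.
Proof.
move=> AB B0 e d e0 d0; have [U [BU Ud Ue]] := B0 e d e0 d0.
by exists U; split => //; exact: subset_trans BU.
Qed.

(** Interleaves two covers of cost [e / 2]: even indices cover [A], odd ones cover [B]. A partial
    sum is first lengthened to [n.*2] terms, where it splits exactly. *)
Lemma hausdorff_nullU (R : realType) (s : R) (A B : set R) :
  hausdorff_null s A -> hausdorff_null s B -> hausdorff_null s (A `|` B).
Proof.
move=> A0 B0 e d e0 d0; have e20 : 0 < e / 2 by rewrite divr_gt0.
have [U [AU Ud Ue]] := A0 _ d e20 d0.
have [V [BV Vd Ve]] := B0 _ d e20 d0.
pose W i := if odd i then V i./2 else U i./2.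
exists W; split.
- move=> x [/AU|/BV] [i _ xi].
    by exists i.*2 => //; rewrite /W odd_double doubleK.
  by exists i.*2.+1 => //; rewrite /W /= odd_double /= uphalf_double.
- by move=> i; rewrite /W; case: ifP.
move=> n.
have W2 : (\sum_(0 <= i < n.*2) diam_powR s (W i) =
           \sum_(0 <= i < n) diam_powR s (U i)
           + \sum_(0 <= i < n) diam_powR s (V i))%E.
  elim: n => [|n IH]; first by rewrite !big_geq// adde0.
  rewrite doubleS !big_nat_recr//= IH /W /= odd_double /= uphalf_double doubleK.
  by rewrite addeACA addeA.
apply: (@le_trans _ _ (\sum_(0 <= i < n.*2) diam_powR s (W i))%E).
  have n2 : (n <= n.*2)%N by rewrite -addnn leq_addr.
  rewrite [leRHS](@big_cat_nat _ _ _ n)//=.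
  by rewrite leeDl// sume_ge0// => i _; exact: diam_powR_ge0.
rewrite W2 (_ : e = e / 2 + e / 2); last by field.
by rewrite EFinD leeD.
Qed.

(** A finite union of closed intervals is closed, so a finite cover of [A] by such intervals also
    covers its closure. *)
Lemma closure_hausdorff_null (R : realType) (s : R) (A : set R) :
  0 <= s ->
  (forall eps : R, 0 < eps -> exists (N : nat) (c : nat -> R) (d : R),
    [/\ 0 <= d <= eps, N%:R * d `^ s <= eps &
        forall x, A x -> exists2 j, (j < N)%N & c j <= x <= c j + d]) ->
  hausdorff_null s (closure A).
Proof.
move=> s0 fcov e d e0 d0.
have ed0 : 0 < Num.min e d by rewrite lt_min e0.
have [N [c [l [/andP[l0 lle] Nle Ac]]]] := fcov _ ed0.
have cl j x y : c j <= x <= c j + l -> c j <= y <= c j + l -> `|x - y| <= l.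
  by rewrite ler_norml; lra.
pose U j := if (j < N)%N then [set x | c j <= x <= c j + l] else set0.
have UE j : (j < N)%N -> U j = `[c j, c j + l]%classic.
  by move=> jN; rewrite /U jN; apply/seteqP; split => x; rewrite /= in_itv.
exists U; split.
- apply: (@subset_trans _ (\bigcup_(j in `I_N) U j)); last first.
    by move=> x [j _ Uj]; exists j.
  have /closure_id -> : closed (\bigcup_(j in `I_N) U j).
    apply: closed_bigcup; first exact: finite_II.
    by move=> j jN; rewrite UE//; exact: interval_closed.
  apply: closureS => x /Ac[j jN xj].
  by exists j => //; rewrite /U jN.
- move=> j; apply: diam_le => x y; rewrite /U; case: ifP => // _ xj yj.
  by rewrite (le_trans (cl _ _ _ xj yj))// (le_trans lle)// ge_min lexx orbT.
move=> n; apply: (@le_trans _ _ (N%:R * l `^ s)%:E); last first.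
  by rewrite lee_fin (le_trans Nle)// ge_min lexx.
(* Past index [N] the cover is padded with [set0], which costs 0 for every [s], including
   [s = 0]. *)
suff [nN|nN] : (n <= N)%N /\
    (\sum_(0 <= i < n) diam_powR s (U i) <= (n%:R * l `^ s)%:E)%E
  \/ (N <= n)%N /\
    (\sum_(0 <= i < n) diam_powR s (U i) <= (N%:R * l `^ s)%:E)%E.
- apply: le_trans nN.2 _; rewrite lee_fin ler_wpM2r ?powR_ge0//.
  by rewrite ler_nat nN.1.
- exact: nN.2.
elim: n => [|n [[nN IH]|[nN IH]]].
- by left; rewrite big_geq// lee_fin mul0r.
- rewrite big_nat_recr//=; case: (ltnP n N) => nN'; [left|right].
    split => //; rewrite -natr1 mulrDl mul1r EFinD leeD//.
    by apply: diam_powR_le => // x y; rewrite /U nN'; exact: cl.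
  split; first exact: leqW.
  have -> : N = n by apply/eqP; rewrite eqn_leq nN' nN.
  by rewrite {2}/U ltnNge nN' /= /diam_powR eqxx adde0.
- rewrite big_nat_recr//=; right; split; first exact: leqW.
  by rewrite {2}/U ltnNge nN /= /diam_powR eqxx adde0.
Qed.

(* Mass distribution principle, without a mass: preimages under [psi] of a cheap
   cover of [A] would cover [[u, v[] with too little Lebesgue measure. *)
Lemma holder_inv_not_hausdorff_null (R : realType) (s K u v : R) (psi : R -> R)
    (A : set R) :
  0 <= s -> 0 < K -> u < v ->
  (forall t t', u <= t < v -> u <= t' < v ->
    `|t - t'| <= K * `|psi t - psi t'| `^ s) ->
  (forall t, u <= t < v -> A (psi t)) ->
  ~ hausdorff_null s A.
Proof.
move=> s0 K0 uv psiH Apsi A0.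
(* With this cost the intervals [J i] below, of length [2 * K] times [diam_powR s (U i)], have total
   length at most half of [v - u]. *)
have e0 : 0 < (v - u) / (4 * K) by rewrite divr_gt0 ?subr_gt0// mulr_gt0.
have [U [AU Ud Ue]] := A0 _ 1 e0 ltr01.
have Ufin i : diam_powR s (U i) \is a fin_num.
  rewrite ge0_fin_numE ?diam_powR_ge0// /diam_powR; case: ifP => // _.
  by apply: poweR_lty; apply: le_lt_trans (Ud i) _; rewrite ltry.
pose d i := K * fine (diam_powR s (U i)).
have d0 i : 0 <= d i by rewrite mulr_ge0 ?(ltW K0)// fine_ge0// diam_powR_ge0.
pose T i := [set t | u <= t < v /\ U i (psi t)].
(* When no parameter is sent into [U i], [c i] is the default 0; the length of [J i] is the same in
   either case. *)
pose c i := xget 0 (T i).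
pose J i : set R := `[c i - d i, c i + d i]%classic.
have uvJ : `[u, v[%classic `<=` \bigcup_i J i.
  move=> t; rewrite /= in_itv /= => tuv.
  have [i _ Ui] := AU _ (Apsi t tuv); exists i => //.
  have [cuv Uc] : T i (c i) by apply: (xgetPex 0); exists t.
  have : `|t - c i| <= d i.
    rewrite (le_trans (psiH _ _ tuv cuv))// ler_pM2l// -lee_fin fineK//.
    exact: dist_powR_le_diam_powR.
  by rewrite /J /= in_itv /= ler_norml; lra.
have mJ i : lebesgue_measure (J i) = ((2 * K)%:E * diam_powR s (U i))%E.
  rewrite /J lebesgue_measure_itv /= lte_fin -[diam_powR s (U i)]fineK//.
  rewrite -EFinM -mulrA -/(d i).
  case: ifPn => [_|dle]; first by rewrite -EFinB; congr EFin; ring.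
  by have -> : d i = 0; [have := d0 i; lra | rewrite mulr0].
have : (lebesgue_measure (`[u, v[%classic : set R) <=
        \sum_(0 <= i <oo) lebesgue_measure (J i))%E.
  exact: (@measure_sigma_subadditive _ _ _ (@lebesgue_measure R)
    `[u, v[%classic J
  (fun i => measurable_itv _) (measurable_itv _) uvJ).
rewrite lebesgue_measure_itv /= lte_fin uv -EFinB leNgt => /negP; apply.
apply: (@le_lt_trans _ _ ((v - u) / 2)%:E); last by rewrite lte_fin; lra.
apply: lime_le; first by apply: is_cvg_nneseries => i _ _; exact: measure_ge0.
apply: nearW => n; under eq_bigr do rewrite mJ.
rewrite -ge0_sume_distrr; last by move=> i _; exact: diam_powR_ge0.
apply: (@le_trans _ _ ((2 * K)%:E * ((v - u) / (4 * K))%:E)%E).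
  by rewrite lee_pmul2l// lte_fin mulr_gt0.
rewrite -EFinM lee_fin; have Kn0 := lt0r_neq0 K0.
by rewrite le_eqVlt; apply/orP; left; apply/eqP; field.
Qed.

(** An interior point would give an interval [[x, x + e[] inside [A], and the identity map on it
    satisfies the Hoelder bound with exponent and constant 1. *)
Lemma hausdorff_null1_interior (R : realType) (A : set R) :
  hausdorff_null 1 A -> interior A = set0.
Proof.
move=> A0; apply/seteqP; split => // x /= /nbhs_ballP[e /= e0 xeA].
apply: (@holder_inv_not_hausdorff_null _ 1 1 x (x + e) id) A0 => //.
- by rewrite ltrDl.
- by move=> t t' _ _; rewrite mul1r powRr1.
- move=> t txe; apply: xeA; rewrite /ball /= ltr_norml; lra.
Qed.

(** * Cantor sets of prescribed dimension *)

(** Left end of the [j]-th piece of level [n]. The parent has index [j./2]; an odd [j] is the right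
    child, flush with the right end of its parent. *)
Fixpoint cantor_left (R : realType) (a : R) (l : nat -> R) (n j : nat) : R :=
  if n is m.+1 then cantor_left a l m j./2 + (odd j)%:R * (l m - l m.+1)
  else a.

Definition dyadic_index (R : realType) (t : R) (n : nat) : nat :=
  Num.truncn (2 ^+ n * t).

(** The point whose left-right address is the binary expansion of [t], obtained as the supremum of
    the left ends of the nested pieces along that address. *)
Definition cantor_param (R : realType) (a : R) (l : nat -> R) (t : R) : R :=
  sup (range (fun n => cantor_left a l n (dyadic_index t n))).

Lemma dyadic_index_half (R : realType) (t : R) (n : nat) :
  0 <= t -> (dyadic_index t n.+1)./2 = dyadic_index t n.
Proof.
move=> t0; apply/esym/eqP.
have y0 : 0 <= 2 ^+ n * t by rewrite mulr_ge0// exprn_ge0.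
have y20 : 0 <= 2 ^+ n.+1 * t by rewrite mulr_ge0// exprn_ge0.
have := truncn_itv y20; rewrite truncn_eq// -/(dyadic_index t n.+1).
set k := dyadic_index _ _; rewrite -{1 2}(odd_double_half k) exprS -mulrA.
rewrite -!natr1 !natrD -muln2 natrM.
by case: (odd k) => /=; lra.
Qed.

Lemma dyadic_index_lt (R : realType) (t : R) (n : nat) :
  0 <= t < 1 -> (dyadic_index t n < 2 ^ n)%N.
Proof.
move=> /andP[t0 t1]; have p0 : (0 : R) < 2 ^+ n by rewrite exprn_gt0.
rewrite truncn_lt_nat; last by rewrite mulr_ge0// ltW.
by rewrite natrX -[ltRHS]mulr1 ltr_pM2l.
Qed.

(** Each child shares one end with its parent and is no longer than it, so the pieces along the
    address of [t] are nested. *)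
Lemma cantor_left_mono (R : realType) (a : R) (l : nat -> R) (t : R)
    (m n : nat) :
  (forall k, 0 <= l k.+1 <= l k) -> 0 <= t -> (m <= n)%N ->
  cantor_left a l m (dyadic_index t m) <= cantor_left a l n (dyadic_index t n)
  /\ cantor_left a l n (dyadic_index t n) + l n
     <= cantor_left a l m (dyadic_index t m) + l m.
Proof.
move=> lS t0; elim: n => [|n IH]; first by rewrite leqn0 => /eqP ->.
rewrite leq_eqVlt => /predU1P[-> //|/IH]; rewrite /= dyadic_index_half//.
by have := lS n; case: (odd _) => /=; lra.
Qed.

(** By nesting, every right end bounds every left end, whatever their levels; the supremum therefore
    lies in all the pieces. *)
Lemma cantor_param_itv (R : realType) (a : R) (l : nat -> R) (t : R)
    (n : nat) :
  (forall k, 0 <= l k.+1 <= l k) -> 0 <= t ->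
  cantor_left a l n (dyadic_index t n) <= cantor_param a l t
    <= cantor_left a l n (dyadic_index t n) + l n.
Proof.
move=> lS t0.
have l0 k : 0 <= l k by case/andP: (lS k); exact: le_trans.
have ub k : ubound (range (fun n => cantor_left a l n (dyadic_index t n)))
                   (cantor_left a l k (dyadic_index t k) + l k).
  move=> _ [m _ <-]; case/orP: (leq_total m k) => mk.
    have [+ _] := cantor_left_mono a lS t0 mk; have := l0 k; lra.
  have [_] := cantor_left_mono a lS t0 mk; have := l0 m; lra.
apply/andP; split.
  by apply: ub_le_sup; [eexists; exact: (ub 0%N)|exists n].
by apply: ge_sup; [exists (cantor_left a l 0 (dyadic_index t 0)), 0%N|].
Qed.

(** Let [n.+1] be the first level at which the addresses differ. Sharing a dyadic interval of level
    [n] bounds [u - t]; lying in opposite children of one piece separates the images by the gap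
    between these children. *)
Lemma cantor_param_sep (R : realType) (a : R) (l : nat -> R) (t u : R) :
  (forall k, 0 <= l k.+1 /\ 2 * l k.+1 <= l k) -> 0 <= t -> t < u -> u < 1 ->
  exists n, u - t <= (2^-1) ^+ n /\
    l n - 2 * l n.+1 <= cantor_param a l u - cantor_param a l t.
Proof.
move=> l2 t0 tu u1; have u0 : 0 <= u by lra.
have lS k : 0 <= l k.+1 <= l k by have := l2 k; lra.
have idx k : (dyadic_index t k <= dyadic_index u k)%N.
  by apply: le_truncn; rewrite ler_wpM2l ?exprn_ge0// ltW.
have idx_eq k : dyadic_index t k = dyadic_index u k -> 2 ^+ k * (u - t) < 1.
  move=> tuk; have p0 : (0 : R) <= 2 ^+ k by rewrite exprn_ge0.
  have /andP[+ _] := truncn_itv (mulr_ge0 p0 t0).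
  have /andP[_] := truncn_itv (mulr_ge0 p0 u0).
  by rewrite -!/(dyadic_index _ _) tuk -natr1 mulrBr; lra.
have [n tun ltn] : exists2 n, dyadic_index t n = dyadic_index u n &
    (dyadic_index t n.+1 < dyadic_index u n.+1)%N.
  (* Equal indices at level [k] force [2 ^+ k * (u - t) < 1], which fails for large [k]. *)
  have ex : exists n, dyadic_index t n != dyadic_index u n.
    have [n un] : exists n : nat, (u - t)^-1 < n%:R.
      by exists (Num.truncn (u - t)^-1).+1; exact: truncnS_gt.
    exists n; apply/negP => /eqP /idx_eq; apply/negP; rewrite -leNgt.
    rewrite -ler_pdivrMr ?subr_gt0// mul1r (le_trans (ltW un))//.
    by rewrite -natrX ler_nat ltnW// ltn_expl.
  (* Level 0 is excluded because both indices are 0 there. *)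
  case: (ex_minnP ex) => -[|n] nE nmin.
    have idx0 x : 0 <= x < 1 -> dyadic_index x 0 = 0%N.
      by move=> /(@dyadic_index_lt _ _ 0); rewrite expn0 ltnS leqn0 => /eqP.
    by move: nE; rewrite !idx0 ?eqxx//; lra.
  exists n; last by rewrite ltn_neqAle nE idx.
  by apply/eqP/negPn/negP => /nmin; rewrite ltnn.
exists n; split.
  have p0 : (0 : R) < 2 ^+ n by rewrite exprn_gt0.
  by rewrite exprVn -[leRHS]mul1r ler_pdivlMr// mulrC ltW// idx_eq.
have /andP[_ tle] := cantor_param_itv a n.+1 lS t0.
have /andP[ule _] := cantor_param_itv a n.+1 lS u0.
have th := dyadic_index_half n t0; have uh := dyadic_index_half n u0.
(* The two indices have equal halves and are strictly ordered, so only the parity bit differs. *)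
have [todd uodd] : odd (dyadic_index t n.+1) = false /\
    odd (dyadic_index u n.+1) = true.
  by move: th uh ltn tun; lia.
move: tle ule; rewrite /= th uh todd uodd tun /=; lra.
Qed.

(** The parameter 1 is excluded because its index [2 ^ n] names no piece of level [n]. Addresses
    ending in all ones never occur, so this set need not be closed. *)
Definition cantor_set (R : realType) (a : R) (l : nat -> R) : set R :=
  [set cantor_param a l t | t in [set t | 0 <= t < 1]].

Lemma cantor_set_null (R : realType) (s a : R) (l : nat -> R) :
  0 <= s -> (forall k, 0 <= l k.+1 <= l k) ->
  (forall e, 0 < e -> exists n, l n <= e /\ 2 ^+ n * l n `^ s <= e) ->
  hausdorff_null s (closure (cantor_set a l)).
Proof.
move=> s0 lS small; apply: closure_hausdorff_null => // e e0.
have [n [le1 le2]] := small e e0.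
exists (2 ^ n)%N, (cantor_left a l n), (l n); split.
- by rewrite le1 andbT; case/andP: (lS n); exact: le_trans.
- by rewrite natrX.
- move=> _ [t /= t01 <-]; exists (dyadic_index t n).
    exact: dyadic_index_lt.
  by apply: cantor_param_itv => //; case/andP: t01.
Qed.

(** Distinct parameters at first separated after level [n] are at most [2^-n] apart, while their
    images are at least a gap apart; the hypothesis on gaps thus makes the inverse of [cantor_param]
    Hoelder of exponent [s]. *)
Lemma cantor_set_not_null (R : realType) (s K a : R) (l : nat -> R) :
  0 <= s -> 0 < K -> (forall k, 0 <= l k.+1 /\ 2 * l k.+1 <= l k) ->
  (forall n, 2^-1 ^+ n <= K * (l n - 2 * l n.+1) `^ s) ->
  ~ hausdorff_null s (cantor_set a l).
Proof.
move=> s0 K0 l2 lK.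
have sep t u : 0 <= t < 1 -> 0 <= u < 1 -> t < u ->
    `|t - u| <= K * `|cantor_param a l t - cantor_param a l u| `^ s.
  move=> /andP[t0 _] /andP[_ u1] tu.
  have [n [tun lun]] := cantor_param_sep a l2 t0 tu u1.
  have ln := l2 n; rewrite distrC gtr0_norm ?subr_gt0//.
  rewrite (le_trans tun)// (le_trans (lK n))// ler_pM2l//.
  rewrite distrC ger0_norm; last lra.
  by apply: ge0_ler_powR => //; rewrite nnegrE; lra.
apply: (holder_inv_not_hausdorff_null s0 K0 (@ltr01 R)).
  move=> t u t01 u01; have [tu|ut|->] := ltgtP t u.
  - exact: sep.
  - by rewrite distrC (distrC (cantor_param _ _ _)); exact: sep.
  - by rewrite subrr normr0 mulr_ge0 ?powR_ge0// ltW.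
by move=> t t01; exists t.
Qed.

Lemma bernoulli_ineq (R : realDomainType) (h : R) (n : nat) :
  0 <= h -> 1 + n%:R * h <= (1 + h) ^+ n.
Proof.
move=> h0; elim: n => [|n IH]; first by rewrite expr0 mul0r addr0.
rewrite exprS -natr1 (le_trans _ (ler_wpM2l _ IH))//; last lra.
have : 0 <= n%:R * h * h by rewrite !mulr_ge0.
by nra.
Qed.

(* The factor [n.+1%:R^-1] keeps the closure Lebesgue-null even for
   [theta = 1], without changing the dimension. *)
Definition cantor_len (R : realType) (theta c : R) (n : nat) : R :=
  (2 `^ (- theta^-1)) ^+ n * (c / n.+1%:R).

Section cantor_len.
Variables (R : realType) (theta c : R).
Hypotheses (theta_gt0 : 0 < theta) (theta_le1 : theta <= 1) (c_gt0 : 0 < c).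

Let r : R := 2 `^ (- theta^-1).
Let l := cantor_len theta c.

Let c_ge0 : 0 <= c. Proof. exact: ltW. Qed.

Let r_gt0 : 0 < r. Proof. by rewrite powR_gt0. Qed.

Let r_ge0 : 0 <= r. Proof. exact: ltW. Qed.

Let r_theta : r `^ theta = 2^-1.
Proof.
by rewrite /r -powRrM mulNr mulVf ?lt0r_neq0// powR_inv1.
Qed.

Let r_le : 2 * r <= 1.
Proof.
rewrite -ler_pdivlMl// mulr1 /r powRN lef_pV2 ?posrE ?powR_gt0//.
rewrite -{1}[2]powRr1//; apply: ler_powR; first by rewrite ler1n.
by rewrite invf_ge1.
Qed.

Let r01 : 0 < r <= 1. Proof. by rewrite r_gt0; have := r_le; lra. Qed.

Let powR_exprn (x y : R) n : 0 <= x -> (x ^+ n) `^ y = (x `^ y) ^+ n.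
Proof.
by move=> x0; rewrite -powR_mulrn// -powRrM mulrC powRrM powR_mulrn// powR_ge0.
Qed.

(** Since [2 * r <= 1], the gap is at least [c * r ^+ n] times the difference of the inverses of
    [n + 1] and [n + 2], which is at least the inverse square of [n + 2]. The gap is thus positive
    even when [r = 1/2]. *)
Lemma cantor_len_gap n : c / n.+2%:R ^+ 2 * r ^+ n <= l n - 2 * l n.+1.
Proof.
have rn0 : 0 < r ^+ n by rewrite exprn_gt0.
have n1 : (0 : R) < n.+1%:R by [].
apply: (@le_trans _ _ (r ^+ n * (c / n.+1%:R - c / n.+2%:R))).
  rewrite mulrC ler_pM2l// -mulrBr ler_pM2l//.
  rewrite -[n.+2%:R]natr1; move: n1; move: (n.+1%:R : R) => x x0.
  have xn0 : x != 0 by lra.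
  have x1n0 : x + 1 != 0 by lra.
  rewrite (_ : x^-1 - (x + 1)^-1 = (x * (x + 1))^-1); last by field; apply/andP.
  by rewrite lef_pV2 ?posrE; nra.
have -> : l n - 2 * l n.+1 =
    r ^+ n * (c / n.+1%:R - 2 * r * (c / n.+2%:R)).
  by rewrite /l /cantor_len -/r exprS; ring.
rewrite ler_pM2l// lerD2l lerN2 ler_piMl// divr_ge0//.
Qed.

Lemma cantor_len_half n : 0 <= l n.+1 /\ 2 * l n.+1 <= l n.
Proof.
split; first by rewrite mulr_ge0 ?exprn_ge0 ?divr_ge0.
rewrite -subr_ge0 (le_trans _ (cantor_len_gap n))//.
by rewrite mulr_ge0 ?exprn_ge0 ?divr_ge0 ?exprn_ge0.
Qed.

(** The cost factors as [(2 * r]^ s) ^+ n[times](c / n.+1%:R) [^ s]: the first factor is at most 1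
    because [theta <= s], and the second tends to 0. *)
Lemma cantor_len_small (s e : R) : theta <= s -> 0 < e ->
  exists n, l n <= e /\ 2 ^+ n * l n `^ s <= e.
Proof.
move=> ths e0; have s0 : 0 < s by exact: lt_le_trans ths.
pose e' := Num.min e (e `^ s^-1).
have e'0 : 0 < e' by rewrite lt_min e0 powR_gt0.
pose n := Num.truncn (c / e').
have cn : c / n.+1%:R <= e'.
  by rewrite ler_pdivrMr// mulrC -ler_pdivrMr// ltW// truncnS_gt.
have cn0 : 0 <= c / n.+1%:R by rewrite divr_ge0.
exists n; split.
  apply: (@le_trans _ _ (c / n.+1%:R)).
    by rewrite /l /cantor_len -/r ler_piMl// exprn_ile1//; case/andP: r01.
  by rewrite (le_trans cn)// ge_min lexx.
rewrite /l /cantor_len -/r powRM ?exprn_ge0// mulrA -[leRHS]mul1r.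
apply: ler_pM.
- by rewrite mulr_ge0 ?powR_ge0// exprn_ge0.
- exact: powR_ge0.
- rewrite powR_exprn// -exprMn exprn_ile1// ?mulr_ge0 ?powR_ge0//.
  by rewrite -ler_pdivlMl// mulr1 -r_theta; exact: ger_powR.
- have -> : e = (e `^ s^-1) `^ s.
    by rewrite -powRrM mulVf ?lt0r_neq0// powRr1// ltW.
  apply: ge0_ler_powR; rewrite ?nnegrE ?powR_ge0 ?(ltW s0)//.
  by rewrite (le_trans cn)// ge_min lexx orbT.
Qed.

Lemma cantor_len_holder (s : R) : 0 <= s -> s < theta ->
  exists2 K, 0 < K & forall n, 2^-1 ^+ n <= K * (l n - 2 * l n.+1) `^ s.
Proof.
move=> s0 sth.
(* The exponent is halved so that the square of [q ^+ n] can be compared with the square of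
   [n.+2%:R]. *)
pose q := r `^ ((s - theta) / 2).
have q1 : 1 < q.
  rewrite /q -opprB mulNr powRN invf_gt1 ?powR_gt0//.
  have x0 : 0 < (theta - s) / 2 by rewrite divr_gt0// subr_gt0.
  have := @gt0_ltr_powR _ _ x0 r 1; rewrite powR1; apply; rewrite ?nnegrE//.
  by have := r_le; have := r_gt0; lra.
have q0 : 0 < q by exact: lt_trans q1.
(* Chosen so that [h * (n + 2) <= 1 + n * (q - 1)], which Bernoulli's inequality bounds by
   [q ^+ n]. *)
pose h := Num.min (q - 1) 1 / 2.
have [h0 hq1 h2] : [/\ 0 < h, 2 * h <= q - 1 & 2 * h <= 1].
  have : [/\ 0 < Num.min (q - 1) 1, Num.min (q - 1) 1 <= q - 1 &
             Num.min (q - 1) 1 <= 1].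
    by rewrite !ge_min !lexx orbT lt_min ltr01 subr_gt0 q1.
  by rewrite /h; move: (Num.min _ _) => m [m0 mq m1]; split; lra.
have K0 : 0 < c `^ s * h ^+ 2 by rewrite mulr_gt0 ?exprn_gt0// powR_gt0.
exists (c `^ s * h ^+ 2)^-1; first by rewrite invr_gt0.
move=> n; rewrite mulrC ler_pdivlMr//.
have n20 : (0 : R) < n.+2%:R by [].
have hq : h * n.+2%:R <= q ^+ n.
  have q10 : 0 <= q - 1 by lra.
  have := bernoulli_ineq n q10; rewrite subrKC; apply: le_trans.
  have : n%:R * h <= n%:R * (q - 1) by rewrite ler_wpM2l//; lra.
  by rewrite -[n.+2%:R]natr1 -natr1; lra.
have rs : (r ^+ n) `^ s = 2^-1 ^+ n * (q ^+ n) ^+ 2.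
  have q2 : q ^+ 2 = r `^ (s - theta).
    by rewrite -powR_mulrn ?(ltW q0)// /q -powRrM divfK.
  rewrite powR_exprn// -exprM mulnC exprM -exprMn -r_theta q2.
  rewrite -powRD; last by apply/implyP => _; rewrite gt_eqF.
  by rewrite addrC subrK.
have c2 : 0 < c / n.+2%:R ^+ 2 by rewrite divr_gt0// exprn_gt0.
apply: (@le_trans _ _ ((c / n.+2%:R ^+ 2 * r ^+ n) `^ s)); last first.
  have cr0 : 0 <= c / n.+2%:R ^+ 2 * r ^+ n.
    by rewrite mulr_ge0 ?exprn_ge0// ltW.
  apply: ge0_ler_powR; rewrite ?nnegrE//; last exact: cantor_len_gap.
  exact: le_trans (cantor_len_gap n).
rewrite powRM ?exprn_ge0 ?(ltW c2)// rs.
rewrite powRM ?invr_ge0 ?exprn_ge0//.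
(* Raising a number of []0, 1]] to a power [s <= 1] does not decrease it. *)
have inv_le : (n.+2%:R ^+ 2)^-1 <= (n.+2%:R ^+ 2)^-1 `^ s :> R.
  apply: ger1_powR; last by rewrite (le_trans (ltW sth)).
  by rewrite invr_gt0 exprn_gt0//= invf_le1 ?exprn_gt0// exprn_ege1// ler1n.
rewrite [leLHS](_ : _ = (c `^ s * 2^-1 ^+ n) * h ^+ 2); last by ring.
rewrite [leRHS](_ : _ = (c `^ s * 2^-1 ^+ n) *
  ((n.+2%:R ^+ 2)^-1 `^ s * (q ^+ n) ^+ 2)); last by ring.
rewrite ler_wpM2l ?mulr_ge0 ?powR_ge0 ?exprn_ge0//.
apply: (@le_trans _ _ ((n.+2%:R ^+ 2)^-1 * (q ^+ n) ^+ 2)); last first.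
  by rewrite ler_wpM2r// exprn_ge0// exprn_ge0// ltW.
rewrite mulrC ler_pdivlMr ?exprn_gt0// -exprMn ler_sqr ?nnegrE//.
  by rewrite mulr_ge0// ltW.
by rewrite exprn_ge0// ltW.
Qed.

End cantor_len.

Lemma exists_closed_dim (R : realType) (theta a b : R) :
  0 <= theta -> theta <= 1 -> a < b ->
  exists C : set R, [/\ C !=set0, closed C, C `<=` `[a, b]%classic,
    forall s, 0 < s -> theta <= s -> hausdorff_null s C &
    forall s, 0 <= s -> hausdorff_null s C -> theta <= s].
Proof.
move=> theta0 theta1 ab.
(* Upper bounds concern the closure and lower bounds only [D], so both pass to [C = closure D]. *)
suff [D [D0 Dab Ds sD]] : exists D : set R,
  [/\ D !=set0, D `<=` `[a, b]%classic,
    forall s, 0 < s -> theta <= s -> hausdorff_null s (closure D) &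
    forall s, 0 <= s -> s < theta -> ~ hausdorff_null s D].
  exists (closure D); split => //.
  - by case: D0 => x Dx; exists x; exact: subset_closure.
  - exact: closed_closure.
  - rewrite [X in _ `<=` X](closure_id _).1; last exact: interval_closed.
    exact: closureS.
  - move=> s s0 /(sub_hausdorff_null (@subset_closure _ D)) Ds0.
    by rewrite leNgt; apply/negP => /(sD s s0).
(* For [theta = 0] a single point is used, covered by one interval of length 0. *)
move: theta0; rewrite le_eqVlt => /predU1P[<-|theta0].
  exists [set a]; split.
  - by exists a.
  - by move=> _ ->; rewrite /= in_itv /= lexx ltW.
  - move=> s s0 _; apply: closure_hausdorff_null; first exact: ltW.
    move=> e e0; exists 1%N, (fun=> a), 0; split.
    + by rewrite lexx ltW.
    + by rewrite powR0 ?gt_eqF// mulr0 ltW.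
    + by move=> _ ->; exists 0%N => //; rewrite addr0 lexx.
  - by move=> s s0 /(le_lt_trans s0); rewrite ltxx.
have c0 : 0 < b - a by rewrite subr_gt0.
pose l := cantor_len theta (b - a).
have l2 := cantor_len_half theta0 theta1 c0.
have lS k : 0 <= l k.+1 <= l k by have := l2 k; rewrite -/l; lra.
exists (cantor_set a l); split.
- by exists (cantor_param a l 0), 0 => //=; rewrite lexx ltr01.
- move=> _ [t /= /andP[t0 _] <-]; have := cantor_param_itv a 0 lS t0.
  by rewrite /= in_itv /= /l /cantor_len expr0 mul1r divr1 subrKC.
- move=> s s0 ths; apply: cantor_set_null => //; first exact: ltW.
  by move=> e; exact: cantor_len_small.
- move=> s s0 sth.
  have [K K0 lK] := cantor_len_holder theta0 theta1 c0 s0 sth.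
  exact: cantor_set_not_null lK.
Qed.

(** * Distance to a set *)

Definition set_dist (R : realType) (A : set R) (x : R) : R :=
  inf [set `|x - a| | a in A].

Section set_dist.
Variables (R : realType) (A : set R).
Hypothesis A0 : A !=set0.

Let lb x : lbound [set `|x - a| | a in A] 0.
Proof. by move=> _ [a _ <-]; exact: normr_ge0. Qed.

Let nonempty x : [set `|x - a| | a in A] !=set0.
Proof. by case: A0 => a Aa; exists `|x - a|, a. Qed.

Lemma set_dist_ge0 x : 0 <= set_dist A x.
Proof. by apply: lb_le_inf; [exact: nonempty|exact: lb]. Qed.

Lemma set_dist_le x a : A a -> set_dist A x <= `|x - a|.
Proof. by move=> Aa; apply: ge_inf; [exists 0; exact: lb|exists a]. Qed.

Lemma set_dist_lipschitz x y : set_dist A x <= `|x - y| + set_dist A y.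
Proof.
rewrite -lerBlDl; apply: lb_le_inf; first exact: nonempty.
move=> _ [a Aa <-]; rewrite lerBlDl (le_trans (set_dist_le x Aa))//.
exact: ler_distD.
Qed.

Lemma set_dist_continuous : continuous (set_dist A).
Proof.
move=> x; apply/cvgrPdist_lt => e e0; near=> y.
have xy : `|x - y| < e by near: y; exact: cvgr_dist_lt.
have := set_dist_lipschitz x y; have := set_dist_lipschitz y x.
by rewrite distrC ltr_norml; lra.
Unshelve. all: by end_near. Qed.

Lemma set_dist_eq0 x : A x -> set_dist A x = 0.
Proof.
move=> Ax; apply/eqP; rewrite eq_le set_dist_ge0 andbT.
by have := set_dist_le x Ax; rewrite subrr normr0.
Qed.

Lemma set_dist_gt0 x : closed A -> ~ A x -> 0 < set_dist A x.
Proof.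
move=> clA nAx.
have /nbhs_ballP[e /= e0 eA] : nbhs x (~` A).
  by apply: open_nbhs_nbhs; split => //; exact: closed_openC.
apply: (lt_le_trans e0); apply: lb_le_inf; first exact: nonempty.
by move=> _ [a Aa <-]; rewrite leNgt; apply/negP => /eA.
Qed.

End set_dist.

(** * Tents *)

(** Half the width of the support, hence the successor in the exponent: the whole support has length
    [2^-(k^2)]. *)
Definition tent_width (R : realType) (k : nat) : R := 2^-1 ^+ (k * k).+1.

(* The 2-adic valuation makes every rational the center of infinitely many
   tents. *)
Definition tent_center (R : realType) (k : nat) : R :=
  ratr (odflt 0 (unpickle (logn 2 k.+1))).

(** A triangle of height [k.+1%:R / tent_width R k], hence of area [k.+1%:R]. *)
Definition tent (R : realType) (k : nat) (x : R) : R :=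
  k.+1%:R / tent_width R k ^+ 2 *
  Num.max 0 (tent_width R k - `|x - tent_center R k|).

Section tent.
Variable R : realType.

Local Notation w := (tent_width R).
Local Notation c := (tent_center R).

Lemma tent_width_gt0 k : 0 < w k.
Proof. by rewrite exprn_gt0. Qed.

Lemma tent_ge0 k (x : R) : 0 <= tent k x.
Proof. by rewrite mulr_ge0 ?divr_ge0 ?exprn_ge0// le_max lexx. Qed.

Lemma tent_continuous k : continuous (@tent R k).
Proof.
move=> x; apply: cvgM; first exact: cvg_cst.
apply: (@continuous_max R R (fun=> 0) (fun x => w k - `|x - c k|)).
  exact: cvg_cst.
apply: cvgB; first exact: cvg_cst.
by apply: cvg_norm; apply: cvgB; [exact: cvg_id|exact: cvg_cst].
Qed.

Lemma tent_eq0 k (x : R) : w k <= `|x - c k| -> tent k x = 0.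
Proof. by move=> wx; rewrite /tent max_l ?mulr0// subr_le0. Qed.

Lemma tent_ge k (x : R) : `|x - c k| <= w k / 2 ->
  k.+1%:R / (2 * w k) <= tent k x.
Proof.
move=> xw; have w0 := tent_width_gt0 k; have wn0 := lt0r_neq0 w0.
rewrite [leLHS](_ : _ = k.+1%:R / w k ^+ 2 * (w k / 2)); last by field.
have h0 : 0 <= k.+1%:R / w k ^+ 2 by rewrite divr_ge0// exprn_ge0// ltW.
by rewrite ler_wpM2l// le_max; apply/orP; right; lra.
Qed.

Definition tent_sum (n : nat) (x : R) : R := \sum_(0 <= k < n) tent k x.

Lemma tent_sum_ge0 n x : 0 <= tent_sum n x.
Proof. by apply: sumr_ge0 => k _; exact: tent_ge0. Qed.

Lemma tent_sum_mono x : nondecreasing_seq (tent_sum ^~ x).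
Proof.
apply/nondecreasing_seqP => n.
by rewrite /tent_sum big_nat_recr//= lerDl tent_ge0.
Qed.

Lemma tent_le_tent_sum k n x : (k < n)%N -> tent k x <= tent_sum n x.
Proof.
move=> kn; apply: le_trans (tent_sum_mono x kn).
by rewrite /tent_sum big_nat_recr//= lerDr tent_sum_ge0.
Qed.

Lemma tent_sum_continuous n : continuous (tent_sum n).
Proof.
elim: n => [|n IH] x.
  rewrite /tent_sum; under eq_fun do rewrite big_geq//; exact: cvg_cst.
rewrite /tent_sum; under eq_fun do rewrite big_nat_recr//=.
by apply: cvgD; [exact: IH|exact: tent_continuous].
Qed.

(** If [x] were outside all supports from index [N] on, the sums would never exceed
    [tent_sum N x]. *)
Lemma tent_sum_cvgy x N : tent_sum n x @[n --> \oo] --> +oo ->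
  exists2 k, (N <= k)%N & `|x - c k| < w k.
Proof.
move=> /cvgryPgt/(_ (tent_sum N x)) [M _ MN].
apply: contrapT => nk; have := MN (maxn M N) (leq_maxl _ _).
rewrite /= ltNge => /negP; apply.
rewrite /tent_sum (@big_cat_nat _ _ _ N)//= ?leq_maxr//.
rewrite [X in _ + X]big1_seq ?addr0// => k /=.
rewrite mem_index_iota => /andP[Nk _]; apply: tent_eq0.
by rewrite leNgt; apply/negP => xk; apply: nk; exists k.
Qed.

Lemma half_expr_le (e : R) : 0 < e ->
  exists N, forall n, (N <= n)%N -> (2^-1 : R) ^+ n <= e.
Proof.
move=> e0; exists (Num.truncn e^-1).+1 => n Nn.
rewrite exprVn -[e]invrK lef_pV2 ?posrE ?exprn_gt0 ?invr_gt0//.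
rewrite (le_trans (ltW (truncnS_gt _)))// -natrX ler_nat.
by rewrite (leq_trans Nn)// ltnW// ltn_expl.
Qed.

(** Any tail of the supports covers the divergence set. The [k]-th support costs at most
    [2^-(k^2 s)], which is at most [2^-k] once [k * s >= 1]. *)
Lemma tent_sum_cvgy_null (s : R) : 0 < s ->
  hausdorff_null s [set x | tent_sum n x @[n --> \oo] --> +oo].
Proof.
move=> s0 e d e0 d0.
have [N1 N1e] : exists N, forall n, (N <= n)%N -> (2^-1 : R) ^+ n <= e / 2.
  by apply: half_expr_le; rewrite divr_gt0.
have [N2 N2d] := half_expr_le d0.
pose N3 := (Num.truncn s^-1).+1.
have N3s m : (N3 <= m)%N -> 1 <= m%:R * s.
  move=> Nm; rewrite -ler_pdivrMr// mul1r (le_trans (ltW (truncnS_gt _)))//.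
  by rewrite ler_nat.
(* [N1] controls the total cost, [N2] the diameters, and [N3] ensures [k * s >= 1]. *)
pose N := maxn N1 (maxn N2 N3).
pose U k := [set x : R | `|x - c (k + N)| < w (k + N)].
have Udist k x y : U k x -> U k y -> `|x - y| <= 2^-1 ^+ ((k + N) * (k + N)).
  rewrite /U /= /tent_width exprS !ltr_norml ler_norml; lra.
exists U; split.
- move=> x /(tent_sum_cvgy N)[k Nk xk]; exists (k - N)%N => //.
  by rewrite /U /= subnK.
- move=> k; apply: diam_le => x y Ux Uy.
  rewrite (le_trans (Udist _ _ _ Ux Uy))// N2d//.
  by rewrite /N; nia.
move=> n.
(* The right-hand side is the exact geometric partial sum, which makes the induction close. *)
have : (\sum_(0 <= i < n) diam_powR s (U i) <=
    (2 * 2^-1 ^+ N - 2 * 2^-1 ^+ (n + N))%:E)%E.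
  elim: n => [|n IH]; first by rewrite big_geq// add0n subrr.
  rewrite big_nat_recr//=.
  have : (diam_powR s (U n) <= (2^-1 ^+ (n + N))%:E)%E.
    apply: le_trans (diam_powR_le (ltW s0) _ (Udist n)) _.
      by rewrite exprn_ge0.
    rewrite lee_fin -powR_mulrn ?invr_ge0// -powRrM natrM -mulrA.
    rewrite -[leRHS]powR_mulrn ?invr_ge0//; apply: ger_powR.
      by rewrite invr_gt0 ltr0n invf_le1//= ler1n.
    by rewrite ler_peMr// N3s// /N; lia.
  move=> /(leeD IH) /le_trans; apply; rewrite -EFinD lee_fin addSn exprS.
  by lra.
move=> /le_trans; apply; rewrite lee_fin.
have : (2^-1 : R) ^+ N <= e / 2 by apply: N1e; rewrite /N; lia.
have : (0 : R) <= 2^-1 ^+ (n + N) by rewrite exprn_ge0.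
lra.
Qed.

Lemma tent_in_itv (x y : R) (M : nat) : x < y ->
  exists2 k, (M <= k)%N & x <= c k - w k / 2 /\ c k + w k / 2 <= y.
Proof.
move=> xy; have [q] := rat_in_itvoo xy; rewrite in_itv /= => /andP[xq qy].
have e0 : 0 < Num.min (ratr q - x) (y - ratr q) by rewrite lt_min !subr_gt0 xq.
have [N Ne] := half_expr_le e0.
(* The 2-adic valuation of [k.+1] is [pickle q], which centers the tent at [q]; the odd factor makes
   [k] large and the tent narrow. *)
pose m := maxn M N; pose k := (2 ^ pickle q * (2 * m).+1).-1.
have kS : k.+1 = (2 ^ pickle q * (2 * m).+1)%N.
  by rewrite prednK// muln_gt0 expn_gt0.
have mk : (m <= k)%N.
  rewrite -ltnS kS; have : (0 < 2 ^ pickle q)%N by rewrite expn_gt0.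
  by move: (2 ^ pickle q)%N; nia.
have ck : c k = ratr q.
  rewrite /tent_center kS lognM ?expn_gt0// pfactorK//.
  rewrite (_ : logn 2 (2 * m).+1 = 0%N) ?addn0 ?pickleK//.
  by rewrite logn_coprime// coprime2n /= mul2n odd_double.
exists k; first by apply: leq_trans mk; exact: leq_maxl.
have : w k <= Num.min (ratr q - x) (y - ratr q).
  by apply: Ne; move: mk; rewrite /m; nia.
have := tent_width_gt0 k; rewrite ck le_min; lra.
Qed.

End tent.

(** * The max-family *)

(** Nullity is asked at positive exponents only, since [hausdorff_measure 0] counts points; the
    upper bound uses the exponents [theta + e]. *)
Lemma hausdorff_dim_eq (R : realType) (A : set R) (theta : R) :
  0 <= theta ->
  (forall s, 0 < s -> theta <= s -> hausdorff_null s A) ->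
  (forall s, 0 <= s -> hausdorff_null s A -> theta <= s) ->
  hausdorff_dim A = theta%:E.
Proof.
move=> theta0 nullA lowA; apply/eqP; rewrite eq_le; apply/andP; split.
  apply/lee_addgt0Pr => e e0; apply: ereal_inf_lbound; exists (theta + e) => //.
  split; first by rewrite addr_ge0// ltW.
  by apply/hausdorff_measure_eq0/nullA; [exact: ltr_wpDl|rewrite lerDl ltW].
apply: le_ereal_inf_tmp => _ [s [s0 /hausdorff_measure_eq0 As] <-].
by rewrite lee_fin lowA.
Qed.

Lemma le_cst_Rintegral (R : realType) (f : R -> R) (x y u v m : R) :
  continuous f -> (forall t, 0 <= f t) -> x <= u -> u < v -> v <= y -> 0 <= m ->
  (forall t, u <= t <= v -> m <= f t) ->
  m * (v - u) <= \int[lebesgue_measure]_(t in `[x, y]) f t.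
Proof.
move=> cf f0 xu uv vy m0 mf.
have xy_int : lebesgue_measure.-integrable `[x, y] (EFin \o f).
  apply: continuous_compact_integrable; first exact: segment_compact.
  exact: continuous_subspaceT.
have mf_meas := measurable_int _ xy_int.
rewrite /Rintegral -lee_fin fineK; last exact: integrable_fin_num.
apply: (@le_trans _ _ (\int[lebesgue_measure]_(t in `[u, v]) (f t)%:E)%E).
  have -> : ((m * (v - u))%:E =
      \int[lebesgue_measure]_(t in `[u, v]) (cst m%:E) t :> \bar R)%E.
    by rewrite integral_cst//= lebesgue_measure_itv /= lte_fin uv -EFinB EFinM.
  apply: ge0_le_integral => //.
  apply: measurable_funS mf_meas => // t.
  by rewrite /= !in_itv /=; lra.
apply: ge0_subset_integral => // t /=; rewrite !in_itv ?lee_fin//=; lra.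
Qed.

Definition spike (R : realType) (A : set R) (n : nat) (x : R) : R :=
  (set_dist A x + n.+1%:R^-1)^-1.

Section spike.
Variables (R : realType) (A : set R).
Hypothesis A0 : A !=set0.

Let den_gt0 n x : 0 < set_dist A x + n.+1%:R^-1.
Proof. by rewrite ltr_wpDl ?set_dist_ge0// invr_gt0. Qed.

Lemma spike_ge0 n x : 0 <= spike A n x.
Proof. by rewrite invr_ge0 ltW. Qed.

Lemma spike_mono x : nondecreasing_seq (spike A ^~ x).
Proof.
apply/nondecreasing_seqP => n.
by rewrite lef_pV2 ?posrE// lerD2l lef_pV2 ?posrE// ler_nat.
Qed.

Lemma spike_continuous n : continuous (spike A n).
Proof.
move=> x; apply: cvgV; first by rewrite gt_eqF.
by apply: cvgD; [exact: set_dist_continuous|exact: cvg_cst].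
Qed.

Lemma spike_mem n x : A x -> spike A n x = n.+1%:R.
Proof. by move=> Ax; rewrite /spike set_dist_eq0// add0r invrK. Qed.

(** The bound does not depend on [n]: off a closed set the spikes cannot cause divergence. *)
Lemma spike_le n x : closed A -> ~ A x -> spike A n x <= (set_dist A x)^-1.
Proof.
move=> clA nAx; have d0 := set_dist_gt0 A0 clA nAx.
by rewrite lef_pV2 ?posrE// lerDl invr_ge0.
Qed.

End spike.

Lemma cvgy_le (R : realType) (u v : nat -> R) (M : R) :
  (forall n, u n <= v n + M) -> u n @[n --> \oo] --> +oo ->
  v n @[n --> \oo] --> +oo.
Proof.
move=> uv /cvgryPge uy; apply/cvgryPge => B.
apply: filterS (uy (B + M)) => n /= Bu.
by rewrite -(lerD2r M) (le_trans Bu).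
Qed.

Lemma cvgy_nat1 (R : realType) : (n.+1%:R : R) @[n --> \oo] --> +oo.
Proof.
apply/cvgryPge => B; apply: filterS (nbhs_infty_ger B) => n /le_trans; apply.
by rewrite ler_nat.
Qed.

Theorem theorem1 (R : realType) (I : set R) (I_itv : is_interval I)
    (I_nondeg : exists x y : R, [/\ I x, I y & x < y])
    (theta : R) (theta_ge0 : 0 <= theta) (theta_le1 : theta <= 1) :
  exists f : nat -> R -> R,
    [/\ max_family I f,
        hausdorff_dim (infinity_set I f) = theta%:E &
        exists A B : set R,
          [/\ infinity_set I f = A `|` B,
              nowhere_dense A &
              hausdorff_dim B = 0%E]].
Proof.
case: I_nondeg => a [b [Ia Ib ab]].
have [C [C0 clC Cab nullC lowC]] := exists_closed_dim theta_ge0 theta_le1 ab.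
have CI : C `<=` I.
  by move=> x /Cab; rewrite /= in_itv /=; exact: (I_itv a b).
pose f n x := tent_sum n x + spike C n x.
pose B := I `&` [set x | tent_sum n x @[n --> \oo] --> +oo].
have nullB s : 0 < s -> hausdorff_null s B.
  by move=> s0; apply: sub_hausdorff_null (tent_sum_cvgy_null s0) => x [].
(* Off [C] the spike part is bounded, so divergence must come from the tents; conversely both parts
   are nonnegative, so either one suffices. *)
have fE : infinity_set I f = C `|` B.
  apply/seteqP; split => x.
    move=> [Ix fx]; have [Cx|nCx] := pselect (C x); first by left.
    right; split => //.
    by apply: cvgy_le fx => n; rewrite lerD2l; exact: spike_le.
  case=> [Cx|[Ix gx]].
    split; first exact: CI.
    apply: (@cvgy_le _ _ _ 0) (@cvgy_nat1 R) => n.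
    by rewrite addr0 /f spike_mem// lerDr tent_sum_ge0.
  split => //; apply: (@cvgy_le _ _ _ 0) gx => n.
  by rewrite addr0 lerDl spike_ge0.
have fcont n : continuous (f n).
  move=> x; apply: cvgD; first exact: tent_sum_continuous.
  exact: spike_continuous.
have f_ge0 n x : 0 <= f n x by rewrite addr_ge0 ?tent_sum_ge0 ?spike_ge0.
exists f; split.
- split=> [n|x _|x y _ _ xy].
  + exact: continuous_subspaceT.
  + by move=> m n mn; rewrite lerD// ?tent_sum_mono ?spike_mono.
  (* A single late tent whose middle half lies in [[x, y]] contributes at least [k.+1%:R / 2]; [m]
     is chosen to make this at least [M]. *)
  + apply/cvgryPge => M; pose m := (2 * Num.truncn M).+2.
    have [k mk [xk ky]] := tent_in_itv m xy.
    have w0 := tent_width_gt0 R k; have wn0 := lt0r_neq0 w0.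
    apply: filterS (nbhs_infty_gt k) => n /= kn.
    apply: (@le_trans _ _ (k.+1%:R / (2 * tent_width R k) *
        (tent_center R k + tent_width R k / 2 -
         (tent_center R k - tent_width R k / 2)))); last first.
      apply: le_cst_Rintegral => //; first lra.
        by rewrite divr_ge0// mulr_ge0// ltW.
      move=> t tk; apply: (@le_trans _ _ (tent k t)).
        by apply: tent_ge; rewrite ler_norml; lra.
      by rewrite (le_trans (tent_le_tent_sum _ kn))// lerDl spike_ge0.
    rewrite [leRHS](_ : _ = k.+1%:R / 2); last by field.
    rewrite ler_pdivlMr// (le_trans (ler_wpM2r _ (ltW (truncnS_gt M))))//.
    rewrite -natrM ler_nat; move: mk; rewrite /m.
    by move: (Num.truncn M) => T; lia.
- rewrite fE; apply: hausdorff_dim_eq => // s s0.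
    by move=> ths; apply: hausdorff_nullU; [exact: nullC|exact: nullB].
  by move=> /(sub_hausdorff_null (@subsetUl _ C B)); exact: lowC.
- exists C, B; split => //.
    (* [C] is its own closure, and [theta <= 1] makes it null for exponent 1. *)
    rewrite /nowhere_dense -(closure_id _).1//.
    by apply: hausdorff_null1_interior; exact: nullC.
  by apply: hausdorff_dim_eq => // s s0 _; exact: nullB.
Qed.
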